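(* Let $\mathcal{C}$ be an $(\alpha+\gamma\beta)$-constacyclic code of length $np^s$ over $\mathcal{R}_2$, i.e., an ideal of the ring $\mathcal{R}_{\alpha,\beta}$. If $\mathcal{C}=\mathcal{C}_1\oplus\mathcal{C}_2\oplus\cdots\oplus\mathcal{C}_r$ with $\mathcal{C}_j$ an ideal of the quotient ring $\mathcal{K}_j$ for each $j$, then the dual code $\mathcal{C}^\perp$ of $\mathcal{C}$ is given by $\mathcal{C}^\perp=\mathcal{C}_1^\perp\oplus\mathcal{C}_2^\perp\oplus\cdots\oplus\mathcal{C}_r^\perp$, where $\mathcal{C}_j^\perp=\{a_j(x)\in\widehat{\mathcal{K}_j}: a_j(x)c_j^*(x)=0 \text{ in }\widehat{\mathcal{K}_j}\text{ for all }c_j(x)\in\mathcal{C}_j\}$ is the orthogonal complement of $\mathcal{C}_j$ for each $j$. Moreover, $\mathcal{C}_j^\perp$ is an ideal of the quotient ring $\widehat{\mathcal{K}_j}=\mathcal{R}_2[x]/\langle k_j^*(x)\rangle$ for each $j$.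
   Context: $\mathcal{R}_2$ is a finite commutative chain ring with unity, with maximal ideal $\langle\gamma\rangle$, where $\gamma\neq0$ and $\gamma^2=0$; its residue field has order $p^m$, $p$ prime. $\zeta\in\mathcal{R}_2$ has multiplicative order $p^m-1$ and $\mathcal{T}_2=\{0,1,\zeta,\dots,\zeta^{p^m-2}\}$. $n,s$ are positive integers with $\gcd(n,p)=1$. $\alpha\in\mathcal{T}_2\setminus\{0\}$, $\beta\in\mathcal{T}_2$, $\lambda=\alpha+\gamma\beta$, and $\alpha_0\in\mathcal{T}_2$ satisfies $\alpha_0^{p^s}=\alpha$. A $\lambda$-constacyclic code of length $N$ over $\mathcal{R}_2$ is a submodule of $\mathcal{R}_2^N$ closed under $(a_0,\dots,a_{N-1})\mapsto(\lambda a_{N-1},a_0,\dots,a_{N-2})$, identified via $(a_i)\mapsto\sum a_ix^i$ with an ideal of $\mathcal{R}_2[x]/\langle x^N-\lambda\rangle$. $\mathcal{R}_{\alpha,\beta}=\mathcal{R}_2[x]/\langle x^{np^s}-\alpha-\gamma\beta\rangle$. The dual code $\mathcal{C}^\perp=\{u\in\mathcal{R}_2^N:\sum u_ic_i=0\ \forall c\in\mathcal{C}\}$ is a $\lambda^{-1}$-constacyclic code, identified with an ideal of $\widehat{\mathcal{R}_{\alpha,\beta}}=\mathcal{R}_2[x]/\langle x^{np^s}-\lambda^{-1}\rangle$. Write $x^n-\alpha_0=f_1(x)\cdots f_r(x)$ with $f_j$ monic, pairwise coprime and basic irreducible (irreducible modulo $\gamma$), $d_j=\deg f_j$. Then $x^{np^s}-\lambda=\prod_{j=1}^rk_j(x)$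 with $k_j(x)=f_j(x)^{p^s}+\gamma g_j(x)$ monic, pairwise coprime, of degree $d_jp^s$, for certain $g_j\in\mathcal{R}_2[x]$ (the $k_j$ are uniquely determined). Put $\mathcal{K}_j=\mathcal{R}_2[x]/\langle k_j(x)\rangle$ and $\widehat{\mathcal{K}_j}=\mathcal{R}_2[x]/\langle k_j^*(x)\rangle$. For a nonzero polynomial $f$, $f^*(x)=x^{\deg f}f(x^{-1})$, and $0^*=0$; elements of $\mathcal{K}_j$ are represented by polynomials of degree less than $d_jp^s$. By the Chinese Remainder Theorem $\mathcal{R}_{\alpha,\beta}\simeq\bigoplus_j\mathcal{K}_j$ and $\widehat{\mathcal{R}_{\alpha,\beta}}\simeq\bigoplus_j\widehat{\mathcal{K}_j}$; the direct sums are understood through these isomorphisms. *)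

(* Defs.v *)
From HB Require Import structures.
From mathcomp Require Import all_boot all_order all_fingroup all_algebra.

Set Implicit Arguments.
Unset Strict Implicit.
Unset Printing Implicit Defensive.

Import GRing.Theory Pdiv.CommonRing Pdiv.RingMonic.
Local Open Scope ring_scope.

(* [idealr_closed] of ring_quotient without the requirement that [1] be outside
   the ideal: the full ring is an ideal too. *)
Definition ideal_closed (A : comNzRingType) (I : {pred A}) : Prop :=
  0 \in I /\ forall a, {in I &, forall u v, a * u + v \in I}.

Definition chain_ring (R : finComUnitRingType) : Prop :=
  forall I J : {set R}, ideal_closed I -> ideal_closed J ->
    I \subset J \/ J \subset I.

Definition principal (R : finComUnitRingType) (g : R) : {set R} :=
  [set g * a | a : R].

Definition maximal_ideal (R : finComUnitRingType) (I : {set R}) : Prop :=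
  [/\ ideal_closed I, I != [set: R] &
      forall J : {set R}, ideal_closed J -> I \subset J ->
        J = I \/ J = [set: R]].

(* By the first isomorphism theorem, [pi] is the quotient map R -> R/<g>, up to
   a unique isomorphism of its codomain. *)
Definition residue_map (R : finComUnitRingType) (g : R) (F : finFieldType)
    (pi : {rmorphism R -> F}) : Prop :=
  (forall y : F, exists x : R, pi x = y) /\
  (forall x : R, pi x = 0 <-> x \in principal g).

(* {0, 1, z, ..., z^(M-1)}, to be used with M the multiplicative order of z *)
Definition teichmuller (R : finComUnitRingType) (z : R) (M : nat) : {set R} :=
  0 |: [set z ^+ (i : 'I_M) | i : 'I_M].

(* <f> + <g> = R[x]; the library's [coprimep] requires an integral domain. *)
Definition comaximal (R : comNzRingType) (f g : {poly R}) : Prop :=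
  exists u v : {poly R}, u * f + v * g = 1.

Section Codes.
Variables (R : finComUnitRingType) (N : nat).

(* (a_0, ..., a_(N-1)) |-> (l * a_(N-1), a_0, ..., a_(N-2)): the value of
   [ord_pred i] is i - 1 modulo N. *)
Definition cshift (l : R) (u : 'rV[R]_N) : 'rV[R]_N :=
  \row_i ((if i == 0%N :> nat then l else 1) * u 0 (ord_pred i)).

Definition constacyclic (l : R) (C : {set 'rV[R]_N}) : Prop :=
  submod_closed C /\ {in C, forall c, cshift l c \in C}.

Definition dual_code (C : {set 'rV[R]_N}) : {set 'rV[R]_N} :=
  [set u : 'rV[R]_N |
    [forall c : 'rV[R]_N in C, \sum_(i < N) u 0 i * c 0 i == 0]].

(* The library's {poly %/ h} is R[x]/<h>, each class being represented by its
   member of degree < deg h, provided that h is monic and nonconstant (h is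
   silently replaced by 'X otherwise). *)
Definition code_ideal (l : R) (C : {set 'rV[R]_N}) :
    {set {poly %/ ('X^N - l%:P)}} :=
  [set in_qpoly ('X^N - l%:P) (rVpoly c) | c in C].

End Codes.

Section DirectSum.
Variables (R : finComUnitRingType) (r : nat).
Variables (h : {poly R}) (k : 'I_r -> {poly R}).

(* The map of the Chinese Remainder Theorem; it is the ring isomorphism from
   R[x]/<h> to the product of the R[x]/<k_j> when h is, up to a unit, the
   product of the pairwise comaximal k_j. *)
Definition crt (c : {poly %/ h}) : {dffun forall j, {poly %/ k j}} :=
  [ffun j => in_qpoly (k j) (val c)].

(* The direct sum of the J_j, seen in R[x]/<h> through [crt]. *)
Definition crt_sum (J : forall j, {set {poly %/ k j}}) : {set {poly %/ h}} :=
  crt @^-1: setXn J.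

End DirectSum.

Section Reciprocal.
Variable R : finComUnitRingType.

(* x^(deg f) * f(1/x), with value 0 at 0: the coefficients of f, reversed *)
Definition reciprocal (f : {poly R}) : {poly R} := Poly (rev f).

Definition normalized (f : {poly R}) : {poly R} := (lead_coef f)^-1 *: f.

(* [reciprocal k] need not be monic even if k is, so R[x]/<reciprocal k> is
   taken modulo its monic associate. This is the same ideal as soon as the
   leading coefficient, which is k(0) if nonzero, is a unit. *)
Definition hat (k : {poly R}) : {poly R} := normalized (reciprocal k).

Lemma in_qpoly_normalized_eq0 (f p : {poly R}) :
    (1 < size f)%N -> lead_coef f \is a GRing.unit ->
  in_qpoly (normalized f) p = 0 <-> exists q, p = q * f.
Proof.
move=> sf uf; have ru : GRing.lreg (lead_coef f)^-1.
  by apply: mulrI; rewrite unitrV.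
have mf : normalized f \is monic by rewrite monicE lead_coef_lreg // mulVr.
have mkE : mk_monic (normalized f) = normalized f.
  by rewrite /mk_monic mf lreg_size // sf.
split=> [/(congr1 val) /= | [q ->]].
  rewrite mkE => /rmodp_eq0P /(rdivpK mf) <-.
  exists (rdivp p (normalized f) * (lead_coef f)^-1%:P).
  by rewrite -mulrA mul_polyC.
apply/val_inj; rewrite /= mkE; apply/rmodp_eq0P/(eq_rdvdp mf (q1 := lead_coef f *: q)).
by rewrite /normalized -scalerAl -scalerAr scalerA divrr // scale1r.
Qed.

(* The orthogonal complement of J in R[x]/<reciprocal k>; [val c] is the
   representative of c of degree < deg k. *)
Definition orth (k : {poly R}) (J : {set {poly %/ k}}) : {set {poly %/ hat k}} :=
  [set a : {poly %/ hat k} |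
    [forall c : {poly %/ k} in J, a * in_qpoly (hat k) (reciprocal (val c)) == 0]].

End Reciprocal.

(* Main.v *)
Require Import Defs.
From HB Require Import structures.
From mathcomp Require Import all_boot all_order all_fingroup all_algebra ring.

(** Let [l] be the constant of the code, [N] its length, [h = x^N - l] and
    [h' = x^N - 1/l]. The proof is that one map, the inversion [x |-> 1/x] of
    the variable, describes both kinds of orthogonality.

    Modulo [h'] the variable has the inverse [w = l x^(N-1)], so the inversion
    is the substitution [c |-> c \Po w] of polynomials. It sends multiples of [h]
    to multiples of [h'], and multiples of [k j] to multiples of the reciprocal
    of [k j]; and [c \Po w] differs from the reciprocal of [c] by a power of
    [x], a unit. Hence the reciprocals in the definition of the orthogonal
    complement may be replaced by the values [c \Po w], which, unlike the
    reciprocals, are additive and multiplicative in [c] ([orthP]).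

    The usual inner product of the words [u] and [c] is the constant coefficient
    of [u * (c \Po w)] modulo [h'] ([coef0_mul_comp_inv_var]). The other
    coefficients are the inner products of [u] with the shifts of [c]; as a
    constacyclic code contains these, [u] is in the dual code if and only if
    [u * (c \Po w)] vanishes modulo [h'] for all codewords [c] ([dual_codeP]).

    Taking reciprocals is multiplicative on monic polynomials, so [h'] is the
    product of the monic associates [hat (k j)] of the reciprocals of the [k j]
    ([prod_hat]), and the inversion carries over the comaximality of the [k j].
    By the Chinese Remainder Theorem, vanishing modulo [h'] is vanishing modulo
    every [hat (k j)] ([in_qpoly_prod_hat]), and the condition modulo [hat (k j)]
    depends only on the component of [c] modulo [k j]. Since the code is the
    full preimage of the product of its components, these components vary
    independently, and the condition splits into one condition for each [j]. *)

Set Implicit Arguments.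
Unset Strict Implicit.
Unset Printing Implicit Defensive.

Import GRing.Theory.
Local Open Scope ring_scope.

(** * Quotients by monic polynomials and the Chinese Remainder Theorem *)

Section Quotient.
Variable A : comNzRingType.
Implicit Types h k p : {poly A}.

Lemma mk_monicE h : h \is monic -> (1 < size h)%N -> mk_monic h = h.
Proof. by move=> hm hs; rewrite /mk_monic hs hm. Qed.

Lemma in_qpoly_eq0 h p : h \is monic -> (1 < size h)%N ->
  in_qpoly h p = 0 <-> exists q, p = q * h.
Proof.
move=> hm hs; split=> [/(congr1 val) /= | [q ->]].
  rewrite mk_monicE // => /Pdiv.CommonRing.rmodp_eq0P h_dvd_p.
  by exists (Pdiv.CommonRing.rdivp p h); rewrite Pdiv.RingMonic.rdivpK.
by apply/val_inj; rewrite /= mk_monicE // Pdiv.RingMonic.rmodp_mull.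
Qed.

Lemma in_qpoly_val h (a : {poly %/ h}) : in_qpoly h (val a) = a.
Proof. by apply/val_inj/Pdiv.CommonRing.rmodp_small/size_mk_monic. Qed.

Lemma size_qpoly h (a : {poly %/ h}) : h \is monic -> (1 < size h)%N ->
  (size (val a) <= (size h).-1)%N.
Proof.
move=> hm hs; rewrite -ltnS prednK ?(ltnW hs) //.
by rewrite (leq_trans (size_mk_monic a)) ?mk_monicE.
Qed.

Lemma in_qpoly_in_qpoly h k p : h \is monic -> (1 < size h)%N ->
  in_qpoly k h = 0 -> in_qpoly k (val (in_qpoly h p)) = in_qpoly k p.
Proof.
move=> hm hs k_h0; rewrite /= mk_monicE //.
rewrite [in RHS](Pdiv.RingMonic.rdivp_eq hm p) in_qpolyD in_qpolyM k_h0.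
by rewrite mulr0 add0r.
Qed.

End Quotient.

Section ChineseRemainder.
Variable A : comNzRingType.
Implicit Types f g h p : {poly A}.

Lemma comaximalMr f g h : comaximal f g -> comaximal f h -> comaximal f (g * h).
Proof.
move=> [u [v uv1]] [u' [v' uv1']].
exists (u * (u' * f + v' * h) + v * g * u'), (v * v').
transitivity ((u * f + v * g) * (u' * f + v' * h)); first by ring.
by rewrite uv1 uv1' mulr1.
Qed.

Lemma comaximal_prodr (I : Type) (s : seq I) (P : pred I) f (k : I -> {poly A}) :
  (forall i, P i -> comaximal f (k i)) -> comaximal f (\prod_(i <- s | P i) k i).
Proof.
move=> cofk; elim/big_rec: _ => [|i p Pi cofp]; last exact/comaximalMr/cofp/cofk.
by exists 0, 1; rewrite mul0r mulr1 add0r.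
Qed.

Lemma comaximal_mul_dvd f g p : comaximal f g ->
  (exists q, p = q * f) -> (exists q, p = q * g) -> exists q, p = q * (f * g).
Proof.
move=> [u [v uv1]] [q pf] [q' pg]; exists (u * q' + v * q).
by rewrite -[p]mul1r -uv1 mulrDl {1}pg pf; ring.
Qed.

Lemma comaximal_prod_dvd (I : eqType) (s : seq I) (k : I -> {poly A}) p :
    uniq s -> (forall i j, i != j -> comaximal (k i) (k j)) ->
    (forall i, exists q, p = q * k i) ->
  exists q, p = q * \prod_(i <- s) k i.
Proof.
move=> + cok k_dvd; elim: s => [_|i s IHs /= /andP[i_notin us]].
  by exists p; rewrite big_nil mulr1.
rewrite big_cons; apply: comaximal_mul_dvd (k_dvd i) (IHs us).
rewrite big_seq; apply: comaximal_prodr => j js; apply: cok.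
by apply: contraNneq i_notin => ->.
Qed.

(** A Chinese Remainder basis element: the cofactor of [k j] is comaximal to
    [k j], so one of its multiples is congruent to 1 modulo [k j]. *)
Lemma crt_idempotent (I : finType) (k : I -> {poly A}) j :
    (forall i i', i != i' -> comaximal (k i) (k i')) ->
  exists e, (exists q, e - 1 = q * k j) /\
            (forall i, i != j -> exists q, e = q * k i).
Proof.
move=> cok.
have [|u [v uv1]] := @comaximal_prodr _ (index_enum I) (fun i => i != j) (k j) k.
  by move=> i /= ij; apply: cok; rewrite eq_sym.
exists (v * \prod_(i | i != j) k i); split.
  by exists (- u); apply/eqP; rewrite subr_eq mulNr -[X in _ + X]uv1 addKr.
move=> i ij; rewrite (bigD1 i) //=.
by exists (v * \prod_(i0 | (i0 != j) && (i0 != i)) k i0); ring.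
Qed.

End ChineseRemainder.

(** * Reciprocals *)

Section ReciprocalAt.
Variable A : comNzRingType.
Implicit Types f g : {poly A}.

(** [x^d * f(1/x)] for a prescribed [d >= deg f]. Unlike the reciprocal, where
    [d] is the degree of [f], it is additive in [f]. *)
Definition reciprocal_at (d : nat) f : {poly A} := \poly_(i < d.+1) f`_(d - i).

Lemma reciprocal_atD d f g :
  reciprocal_at d (f + g) = reciprocal_at d f + reciprocal_at d g.
Proof.
by apply/polyP=> i; rewrite coefD !coef_poly; case: ifP; rewrite ?coefD ?addr0.
Qed.

Lemma reciprocal_at0C c : reciprocal_at 0 c%:P = c%:P.
Proof. by apply/polyP=> i; rewrite coef_poly !coefC; case: i. Qed.

Lemma reciprocal_atZ d c f : reciprocal_at d (c *: f) = c *: reciprocal_at d f.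
Proof.
by apply/polyP=> i; rewrite coefZ !coef_poly; case: ifP; rewrite ?coefZ ?mulr0.
Qed.

Lemma reciprocal_at0 d : reciprocal_at d 0 = 0.
Proof. by apply/polyP=> i; rewrite coef_poly !coef0 if_same. Qed.

Lemma reciprocal_at_mulX d f : reciprocal_at d.+1 (f * 'X) = reciprocal_at d f.
Proof.
apply/polyP=> i; rewrite !coef_poly coefMX subn_eq0.
rewrite !ltnS; case: (leqP i d) => id; last by rewrite if_same.
by rewrite leqW //= subSn.
Qed.

Lemma reciprocal_atS d f : (size f <= d.+1)%N ->
  reciprocal_at d.+1 f = reciprocal_at d f * 'X.
Proof.
move=> sf; apply/polyP=> i; rewrite coefMX !coef_poly.
by case: i => [|i]; [rewrite subn0 nth_default | rewrite subSS].
Qed.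

Lemma reciprocal_at_addn d e f : (size f <= e.+1)%N ->
  reciprocal_at (d + e) f = reciprocal_at e f * 'X^d.
Proof.
move=> sf; elim: d => [|d IHd]; first by rewrite mulr1.
rewrite addSn reciprocal_atS ?IHd ?exprSr ?mulrA //.
by rewrite (leq_trans sf) // ltnS leq_addl.
Qed.

(** The recursion on [d] behind both facts below: peeling off the constant
    coefficient of a polynomial peels off the top coefficient of its reversal. *)
Lemma reciprocal_at_MXaddC d f c :
  reciprocal_at d.+1 (f * 'X + c%:P) = reciprocal_at d f + c *: 'X^(d.+1).
Proof.
rewrite reciprocal_atD reciprocal_at_mulX -[d.+1]addn0 reciprocal_at_addn.
  by rewrite reciprocal_at0C mul_polyC addn0.
exact: size_polyC_leq1.
Qed.

Lemma reciprocal_atM d e f g : (size f <= d.+1)%N -> (size g <= e.+1)%N ->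
  reciprocal_at (d + e) (f * g) = reciprocal_at d f * reciprocal_at e g.
Proof.
move=> + sg; elim: d f => [|d IHd] f.
  by move=> /size1_polyC ->; rewrite reciprocal_at0C !mul_polyC reciprocal_atZ.
elim/poly_ind: f => [|f c _] sf.
  by rewrite mul0r !reciprocal_at0 mul0r.
have {}sf : (size f <= d.+1)%N.
  by move: sf; rewrite size_MXaddC; case: ifP => // /andP[/eqP-> _]; rewrite size_poly0.
rewrite mulrDl mulrAC reciprocal_atD addSn reciprocal_at_mulX IHd //.
rewrite mul_polyC reciprocal_atZ -addSn reciprocal_at_addn // reciprocal_at_MXaddC.
by rewrite mulrDl -scalerAl [_ * 'X^_]mulrC.
Qed.

Lemma reciprocal_at_XnsubC d c : reciprocal_at d ('X^d - c%:P) = 1 - c *: 'X^d.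
Proof.
rewrite -polyCN reciprocal_atD; congr (_ + _).
  by elim: d => [|d IHd]; rewrite ?reciprocal_at0C // exprSr reciprocal_at_mulX.
rewrite -{1}[d]addn0 reciprocal_at_addn; last exact: size_polyC_leq1.
by rewrite reciprocal_at0C polyCN mulNr mul_polyC.
Qed.

(** A ring in which [x] and [w] become inverse to each other cannot tell [w]
    from [1/x], so there the formula [x^d * f(1/x)] is meaningful. *)
Lemma reciprocal_at_comp (B : comNzRingType) (phi : {rmorphism {poly A} -> B})
    (w : {poly A}) d f :
    phi 'X * phi w = 1 -> (size f <= d.+1)%N ->
  phi (reciprocal_at d f) = phi 'X ^+ d * phi (f \Po w).
Proof.
move=> xw1; elim: d f => [|d IHd] f.
  by move=> /size1_polyC ->; rewrite reciprocal_at0C comp_polyC mul1r.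
elim/poly_ind: f => [|f c _] sf.
  by rewrite raddf0 reciprocal_at0 rmorph0 mulr0.
have {}sf : (size f <= d.+1)%N.
  by move: sf; rewrite size_MXaddC; case: ifP => // /andP[/eqP-> _]; rewrite size_poly0.
rewrite reciprocal_at_MXaddC comp_poly_MXaddC !rmorphD IHd // -mul_polyC !rmorphM.
rewrite rmorphXn mulrDr [in RHS]exprSr -[_ * phi 'X * _]mulrA.
by rewrite [phi 'X * (_ * _)]mulrCA xw1 mulr1 -exprSr [phi _%:P * _]mulrC.
Qed.

End ReciprocalAt.

Section Hat.
Variable R : finComUnitRingType.
Implicit Types f g : {poly R}.

Lemma reciprocalE d f : size f = d.+1 -> reciprocal f = reciprocal_at d f.
Proof.
move=> sf; apply/polyP=> i; rewrite coef_Poly coef_poly.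
have [id|di] := ltnP i d.+1; last by rewrite nth_default // size_rev sf.
by rewrite nth_rev sf ?subSS.
Qed.

(** A unit constant coefficient keeps the reversed list free of trailing
    zeros, so that the degree does not drop. *)
Lemma polyseq_reciprocal f : f`_0 \is a GRing.unit -> reciprocal f = rev f :> seq R.
Proof.
rewrite /reciprocal; case: (polyseq f) => [|a s] ua; first by rewrite unitr0 in ua.
apply: (@PolyK _ 0); rewrite rev_cons last_rcons.
by apply: contraTneq ua => /= ->; rewrite unitr0.
Qed.

Lemma lead_coef_reciprocal f :
  f`_0 \is a GRing.unit -> lead_coef (reciprocal f) = f`_0.
Proof.
move=> uf; rewrite lead_coefE polyseq_reciprocal // size_rev.
have sf : (0 < size f)%N.
  by case: (polyseq f) uf => //; rewrite unitr0.
by rewrite nth_rev ?prednK // subnn.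
Qed.

Lemma size_hat f : f`_0 \is a GRing.unit -> size (hat f) = size f.
Proof.
move=> uf; rewrite /hat /normalized lead_coef_reciprocal // lreg_size.
  by rewrite polyseq_reciprocal // size_rev.
by apply: mulrI; rewrite unitrV.
Qed.

Lemma monic_hat f : f`_0 \is a GRing.unit -> hat f \is monic.
Proof.
move=> uf; rewrite monicE /hat /normalized lead_coef_reciprocal //.
rewrite lead_coef_lreg ?lead_coef_reciprocal ?mulVr //.
by apply: mulrI; rewrite unitrV.
Qed.

Lemma hatE f : f`_0 \is a GRing.unit -> hat f = (f`_0)^-1 *: reciprocal f.
Proof. by move=> uf; rewrite /hat /normalized lead_coef_reciprocal. Qed.

Lemma reciprocal_hat f : f`_0 \is a GRing.unit -> reciprocal f = f`_0 *: hat f.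
Proof. by move=> uf; rewrite hatE // scalerA divrr // scale1r. Qed.

Lemma reciprocalM f g : f \is monic -> g \is monic ->
  reciprocal (f * g) = reciprocal f * reciprocal g.
Proof.
move=> fm gm; have [sf sg] := (monic_neq0 fm, monic_neq0 gm).
rewrite -!size_poly_gt0 in sf sg.
rewrite (@reciprocalE (size f).-1 f) ?(@reciprocalE (size g).-1 g) ?prednK //.
rewrite -reciprocal_atM ?prednK //; apply: reciprocalE.
rewrite size_Mmonic ?monic_neq0 //.
by case: (size f) (size g) sf sg => [|a] [|b] //= _ _; rewrite addnS.
Qed.

Lemma hatM f g : f \is monic -> g \is monic ->
    f`_0 \is a GRing.unit -> g`_0 \is a GRing.unit ->
  hat (f * g) = hat f * hat g.
Proof.
move=> fm gm uf ug; rewrite !hatE ?coef0M ?unitrM ?uf ?ug // reciprocalM //.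
by rewrite -scalerAl -scalerAr scalerA invrM // mulrC.
Qed.

Lemma hat1 : hat 1 = 1 :> {poly R}.
Proof.
have c1 : (1 : {poly R})`_0 = 1 by rewrite coef1.
rewrite hatE c1 ?unitr1 // invr1 scale1r (@reciprocalE 0) ?size_poly1 //.
exact: reciprocal_at0C.
Qed.

Lemma hat_prod (I : Type) (s : seq I) (k : I -> {poly R}) :
    (forall i, k i \is monic) -> (forall i, (k i)`_0 \is a GRing.unit) ->
  hat (\prod_(i <- s) k i) = \prod_(i <- s) hat (k i).
Proof.
move=> km uk; elim: s => [|i s IHs]; first by rewrite !big_nil hat1.
rewrite !big_cons hatM ?IHs ?monic_prod //.
by rewrite coef0_prod unitr_prod.
Qed.

Lemma coef0_XnsubC N (l : R) : (0 < N)%N -> ('X^N - l%:P)`_0 = - l.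
Proof. by case: N => // N _; rewrite coefB coefXn coefC sub0r. Qed.

Lemma hat_XnsubC N (l : R) : (0 < N)%N -> l \is a GRing.unit ->
  hat ('X^N - l%:P) = 'X^N - (l^-1)%:P.
Proof.
move=> N_gt0 ul; rewrite hatE coef0_XnsubC ?unitrN // invrN.
rewrite (reciprocalE (size_XnsubC _ N_gt0)) reciprocal_at_XnsubC scalerBr scalerA.
by rewrite mulNr mulVr // scaleN1r opprK addrC scaleNr alg_polyC.
Qed.

End Hat.

(** * Inverting the variable *)

Section Inversion.
Variables (R : finComUnitRingType) (N : nat) (l : R).
Hypotheses (N_gt0 : (0 < N)%N) (ul : l \is a GRing.unit).

Implicit Type f : {poly R}.

Let h : {poly R} := 'X^N - l%:P.
Let h' : {poly R} := 'X^N - (l^-1)%:P.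

(** It inverts the variable modulo [x^N - 1/l], where [l * x^N = 1]. *)
Definition inv_var : {poly R} := l *: 'X^(N.-1).

Let unit_h0 : h`_0 \is a GRing.unit.
Proof. by rewrite coef0_XnsubC // unitrN. Qed.

Section Morphism.
Variables (B : comNzRingType) (phi : {rmorphism {poly R} -> B}).
Hypothesis phi_h' : phi h' = 0.

Lemma inv_varP : phi 'X * phi inv_var = 1.
Proof.
have : phi ('X^N) = phi (l^-1)%:P.
  by apply/eqP; rewrite -subr_eq0 -rmorphB phi_h'.
move=> /(congr1 ( *%R (phi l%:P))).
rewrite -!rmorphM divrr // !rmorph1 => <-.
by congr (phi _); rewrite /inv_var -scalerAr -exprS prednK // mul_polyC.
Qed.

Lemma reciprocal_comp f :
  phi (reciprocal f) = phi 'X ^+ (size f).-1 * phi (f \Po inv_var).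
Proof.
case sf : (size f) => [|d]; last first.
  by rewrite (reciprocalE sf) (reciprocal_at_comp inv_varP) ?sf.
move/eqP: sf; rewrite size_poly_eq0 => /eqP->; rewrite raddf0 rmorph0 mulr0.
by rewrite /reciprocal polyseq0 /= rmorph0.
Qed.

(** [1/x] being a unit, [f(1/x)] and the reciprocal of [f] generate the same
    ideal. *)
Lemma mul_reciprocal_eq0 a f :
  a * phi (reciprocal f) = 0 <-> a * phi (f \Po inv_var) = 0.
Proof.
rewrite reciprocal_comp mulrCA; split=> [|->].
  move=> /(congr1 ( *%R (phi inv_var ^+ (size f).-1))).
  by rewrite [X in X = _ -> _]mulrA -exprMn [phi _ * phi 'X]mulrC
    inv_varP expr1n mul1r mulr0.
by rewrite mulr0.
Qed.

(** The inversion of the variable maps the ideal of [f] into that of its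
    reciprocal. *)
Lemma comp_inv_var_eq0 f : f`_0 \is a GRing.unit -> phi (hat f) = 0 ->
  phi (f \Po inv_var) = 0.
Proof.
move=> uf hat0; rewrite -[LHS]mul1r; apply/mul_reciprocal_eq0.
by rewrite mul1r reciprocal_hat // -mul_polyC rmorphM hat0 mulr0.
Qed.

End Morphism.

Let mh' : h' \is monic. Proof. exact: monicXnsubC. Qed.
Let sh' : size h' = N.+1. Proof. exact: size_XnsubC. Qed.
Local Notation phi := (in_qpoly h').

Let phi_h' : phi h' = 0.
Proof. by apply/(in_qpoly_eq0 _ mh'); rewrite ?sh' //; exists 1; rewrite mul1r. Qed.

Let in_qpoly_smallE f : (size f <= N)%N -> val (phi f) = f.
Proof. by move=> sf; apply: in_qpoly_small; rewrite mk_monicE ?sh'. Qed.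

Let phi_XnwnK n f : phi (f * ('X^n * inv_var ^+ n)) = phi f.
Proof.
rewrite in_qpolyM -exprMn rmorphXn /= in_qpolyM (inv_varP phi_h').
by rewrite expr1n mulr1.
Qed.

(** The powers of the inverse of the variable are dual to those of the variable
    for the form that takes the constant coefficient of a product. *)
Lemma coef0_Xn_inv_var i j : (i < N)%N -> (j < N)%N ->
  (val (phi ('X^i * inv_var ^+ j)))`_0 = (i == j)%:R.
Proof.
move=> iN jN; have [ji|ij] := leqP j i.
  rewrite -{1}(subnK ji) exprD -mulrA phi_XnwnK.
  rewrite in_qpoly_smallE ?size_polyXn ?(leq_ltn_trans (leq_subr _ _)) //.
  by rewrite coefXn eq_sym subn_eq0 eqn_leq ji andbT.
have tN : (j - i <= N)%N by rewrite (leq_trans (leq_subr _ _)) // ltnW.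
have -> : phi ('X^i * inv_var ^+ j) = phi (l *: 'X^(N - (j - i))).
  have -> : phi ('X^i * inv_var ^+ j) = phi (inv_var ^+ (j - i)).
    by rewrite -{1}(subnK (ltnW ij)) exprD mulrCA phi_XnwnK.
  (* modulo x^N - 1/l, the constant 1 is l x^N *)
  have -> : phi (inv_var ^+ (j - i)) = phi (l *: ('X^N * inv_var ^+ (j - i))).
    apply/eqP; rewrite -subr_eq0 -rmorphB /=; apply/eqP.
    apply/(in_qpoly_eq0 _ mh'); first by rewrite sh'.
    exists (- l *: inv_var ^+ (j - i)); rewrite /h' mulrBr -scalerAl mulrC.
    rewrite -scalerAl [_ * _%:P]mulrC mul_polyC scalerA mulNr divrr //.
    by rewrite !scaleNr scale1r opprK addrC.
  by rewrite -(subnK tN) exprD -mulrA scalerAl phi_XnwnK subnK.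
have jiN : (N - (j - i) < N)%N by rewrite ltn_subrL subn_gt0 ij N_gt0.
rewrite in_qpoly_smallE; last first.
  by rewrite (leq_trans (size_scale_leq _ _)) // size_polyXn.
rewrite coefZ coefXn ltn_eqF ?mulr0 ?ltn_eqF //.
by rewrite subn_gt0 (leq_ltn_trans (leq_subr _ _)).
Qed.

(** Only the products of [x^i] with [x^-i] reach the constant coefficient. *)
Lemma coef0_mul_comp_inv_var (u c : 'rV[R]_N) :
  (val (phi (rVpoly u * (rVpoly c \Po inv_var))))`_0 = \sum_(i < N) u 0 i * c 0 i.
Proof.
have rVpolyE (v : 'rV[R]_N) : rVpoly v = \sum_(i < N) v 0 i *: 'X^i.
  by rewrite /rVpoly poly_def; apply: eq_bigr => i _; rewrite valK.
rewrite !rVpolyE linear_sum mulr_suml rmorph_sum /= poly_of_qpoly_sum coef_sum.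
apply: eq_bigr => i _.
rewrite mulr_sumr rmorph_sum /= poly_of_qpoly_sum coef_sum.
have termE j : (val (phi (u 0 i *: 'X^i * (c 0 j *: 'X^j \Po inv_var))))`_0
    = (u 0 i * c 0 j) * (i == j)%:R.
  rewrite comp_polyZ comp_Xn_poly -scalerAr -scalerAl scalerA in_qpolyZ coefZ.
  by rewrite coef0_Xn_inv_var // [c _ _ * _]mulrC.
rewrite (bigD1 i) //= big1 ?addr0 => [|j ji]; rewrite termE.
  by rewrite eqxx mulr1.
by rewrite [_ == _]eq_sym (negPf ji) mulr0.
Qed.

(** The constacyclic shift is multiplication by the variable modulo
    [x^N - l]: the subtracted multiple wraps the top coefficient around. *)
Lemma rVpoly_cshift (c : 'rV[R]_N) :
  rVpoly (cshift l c) = 'X * rVpoly c - (rVpoly c)`_N.-1 *: h.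
Proof.
have coefXnE i : ('X^N : {poly R})`_i = if i == N then 1 else 0.
  by rewrite coefXn; case: (i == N).
apply/polyP=> i; rewrite coefB coefXM coefZ coefB coefXnE coefC.
have coef_ge (p : {poly R}) j : (size p <= N)%N -> (N <= j)%N -> p`_j = 0.
  by move=> sp Nj; rewrite nth_default // (leq_trans sp).
have [iN|Ni] := ltnP i N.
  rewrite (coef_rVpoly_ord _ (Ordinal iN)) mxE /= -coef_rVpoly_ord /=.
  rewrite (ltn_eqF iN).
  have [->|i_gt0] := posnP i.
    rewrite add0n modn_small ?prednK //.
    by rewrite !sub0r mulrN opprK mulrC.
  rewrite subr0 mulr0 subr0 mul1r.
  by rewrite -{1}(prednK i_gt0) addSn /= modnDr modn_small // -ltnS prednK // ltnW.
rewrite coef_ge ?size_poly //.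
have i_gt0 := leq_trans N_gt0 Ni.
rewrite (gtn_eqF i_gt0) subr0; case: ltngtP Ni => // [Ni|<-] _.
  have {}Ni : (N <= i.-1)%N by rewrite -ltnS prednK.
  by rewrite (coef_ge _ _ (size_poly _ _) Ni) mulr0 subr0.
by rewrite mulr1 subrr.
Qed.

Lemma in_qpoly_cshift (c : 'rV[R]_N) :
  phi (rVpoly (cshift l c) \Po inv_var) = phi inv_var * phi (rVpoly c \Po inv_var).
Proof.
have h_w : phi (h \Po inv_var) = 0.
  by apply: (comp_inv_var_eq0 phi_h') => //; rewrite hat_XnsubC.
rewrite rVpoly_cshift comp_polyB comp_polyM comp_polyX comp_polyZ.
by rewrite rmorphB -mul_polyC !rmorphM /= h_w mulr0 subr0.
Qed.

(** The coefficient of [x^t] in [u * c(1/x)] is the inner product of [u] with the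
    [t]-th shift of [c], because that shift contributes a factor [x^-t] which
    moves this coefficient to the constant one. So orthogonality to a shift
    invariant set is the vanishing of all these coefficients. *)
Lemma dual_codeP (C : {set 'rV[R]_N}) (u : 'rV[R]_N) :
    {in C, forall c, cshift l c \in C} ->
  u \in dual_code C <->
  {in C, forall c, phi (rVpoly u * (rVpoly c \Po inv_var)) = 0}.
Proof.
move=> Cshift; rewrite inE; split; last first.
  move=> u_dual; apply/forallP=> c; apply/implyP=> cC.
  by rewrite -coef0_mul_comp_inv_var u_dual // coef0.
move=> /forallP u_orth c cC.
pose q : {poly R} := val (phi (rVpoly u * (rVpoly c \Po inv_var))).
suff q0 t : q`_t = 0 by apply/val_inj/polyP=> t; rewrite coef0; apply: q0.
have sq : (size q <= N)%N.
  have := size_qpoly (phi (rVpoly u * (rVpoly c \Po inv_var))) mh'.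
  by rewrite sh'; apply.
have [tN|Nt] := ltnP t N; last by rewrite nth_default // (leq_trans sq).
have shiftE : phi (rVpoly u * (rVpoly (iter t (cshift l) c) \Po inv_var))
    = phi (q * inv_var ^+ t).
  rewrite [RHS]in_qpolyM in_qpoly_val !in_qpolyM -mulrA; congr (_ * _).
  rewrite rmorphXn /= [RHS]mulrC; elim: (t) => [|t' IHt]; first by rewrite mul1r.
  by rewrite iterS in_qpoly_cshift IHt exprS mulrA.
have <- : (val (phi (q * inv_var ^+ t)))`_0 = q`_t.
  have := coef0_mul_comp_inv_var (poly_rV q) (delta_mx 0 (Ordinal tN)).
  rewrite poly_rV_K // rVpoly_delta comp_Xn_poly => ->.
  rewrite (bigD1 (Ordinal tN)) //= big1 => [|i it]; last first.
    by rewrite !mxE (negPf it) andbF mulr0.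
  by rewrite addr0 !mxE !eqxx mulr1.
have ctC : iter t (cshift l) c \in C by elim: (t) => // t'; apply: Cshift.
by rewrite -shiftE coef0_mul_comp_inv_var; apply/eqP/(implyP (u_orth _)).
Qed.


End Inversion.

(** * The dual of a direct sum *)

Section CodeIdeal.
Variables (R : finComUnitRingType) (N : nat) (l : R) (N_gt0 : (0 < N)%N).

Lemma in_code_ideal (C : {set 'rV[R]_N}) (a : {poly %/ ('X^N - l%:P)}) :
  (a \in code_ideal l C) = (poly_rV (val a) \in C).
Proof.
have [hm hs] := (monicXnsubC l N_gt0, size_XnsubC l N_gt0).
have sa : (size (val a) <= N)%N by have := size_qpoly a hm; rewrite hs; apply.
apply/imsetP/idP => [[c cC ->]|aC]; last first.
  by exists (poly_rV (val a)); rewrite // poly_rV_K // in_qpoly_val.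
rewrite /= Pdiv.CommonRing.rmodp_small ?rVpolyK // mk_monicE ?hs // ltnS.
exact: size_poly.
Qed.

End CodeIdeal.

Lemma orth_ideal (R : finComUnitRingType) (k : {poly R}) (J : {set {poly %/ k}}) :
  ideal_closed (orth J).
Proof.
split=> [|a u v]; first by rewrite inE; apply/forall_inP=> c _; rewrite mul0r.
rewrite !inE => /forall_inP uJ /forall_inP vJ; apply/forall_inP=> c cJ.
by rewrite mulrDl -mulrA (eqP (uJ c cJ)) (eqP (vJ c cJ)) mulr0 addr0.
Qed.

Section DualDecomposition.
Variables (R : finComUnitRingType) (N : nat) (l : R) (r : nat) (k : 'I_r -> {poly R}).
Hypotheses (N_gt0 : (0 < N)%N) (ul : l \is a GRing.unit).
Hypotheses (k_monic : forall j, k j \is monic) (k_size : forall j, (1 < size (k j))%N).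
Hypothesis k_coprime : forall i j, i != j -> comaximal (k i) (k j).
Hypothesis k_prod : 'X^N - l%:P = \prod_(j < r) k j.

Local Notation h := ('X^N - l%:P).
Local Notation h' := ('X^N - (l^-1)%:P).
Local Notation w := (inv_var N l).

Let unit_k0 j : (k j)`_0 \is a GRing.unit.
Proof.
have : (h : {poly R})`_0 \is a GRing.unit by rewrite coef0_XnsubC // unitrN.
by rewrite k_prod coef0_prod => /unitr_prodP; apply; rewrite ?mem_index_enum.
Qed.

Let hat_monic j : hat (k j) \is monic. Proof. exact: monic_hat. Qed.
Let hat_size j : (1 < size (hat (k j)))%N. Proof. by rewrite size_hat. Qed.

Lemma prod_hat : h' = \prod_(j < r) hat (k j).
Proof. by rewrite -hat_XnsubC // k_prod hat_prod. Qed.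

Let k_dvd_h j : in_qpoly (k j) h = 0.
Proof.
apply/in_qpoly_eq0 => //; exists (\prod_(i | i != j) k i).
by rewrite k_prod (bigD1 j) //= mulrC.
Qed.

Let hat_dvd_h' j : in_qpoly (hat (k j)) h' = 0.
Proof.
apply/in_qpoly_eq0 => //; exists (\prod_(i | i != j) hat (k i)).
by rewrite prod_hat (bigD1 j) //= mulrC.
Qed.

Let hat_k_comp j : in_qpoly (hat (k j)) (k j \Po w) = 0.
Proof.
apply: (comp_inv_var_eq0 N_gt0 ul (hat_dvd_h' j)) => //.
by apply/in_qpoly_eq0 => //; exists 1; rewrite mul1r.
Qed.

(** Inverting the variable is a well-defined map from the quotient by [k j] to
    the quotient by its reciprocal. *)
Lemma in_qpoly_comp_inv_var j p q : in_qpoly (k j) p = in_qpoly (k j) q ->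
  in_qpoly (hat (k j)) (p \Po w) = in_qpoly (hat (k j)) (q \Po w).
Proof.
move=> /eqP; rewrite -subr_eq0 -rmorphB /= => /eqP /in_qpoly_eq0 [] // t pq.
apply/eqP; rewrite -subr_eq0 -rmorphB -comp_polyB pq comp_polyM rmorphM /=.
by rewrite hat_k_comp mulr0.
Qed.

(** Invert the variable in a Bezout relation for [k i] and [k j]. *)
Lemma hat_comaximal i j : i != j -> comaximal (hat (k i)) (hat (k j)).
Proof.
move=> /k_coprime [u [v uv1]].
have [qi ki] := (in_qpoly_eq0 _ (hat_monic i) (hat_size i)).1 (hat_k_comp i).
have [qj kj] := (in_qpoly_eq0 _ (hat_monic j) (hat_size j)).1 (hat_k_comp j).
exists ((u \Po w) * qi), ((v \Po w) * qj).
by rewrite -!mulrA -ki -kj -!comp_polyM -comp_polyD uv1 comp_polyC.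
Qed.

Lemma in_qpoly_prod_hat p :
  in_qpoly h' p = 0 <-> forall j, in_qpoly (hat (k j)) p = 0.
Proof.
have h'm : h' \is monic by apply: monicXnsubC.
have h's : (1 < size (h' : {poly R}))%N by rewrite size_XnsubC.
split=> [p0 j | p0].
  have [q ->] := (in_qpoly_eq0 p h'm h's).1 p0.
  by rewrite in_qpolyM hat_dvd_h' mulr0.
apply/in_qpoly_eq0 => //.
rewrite prod_hat; apply: comaximal_prod_dvd; first exact: index_enum_uniq.
  exact: hat_comaximal.
by move=> j; apply/in_qpoly_eq0.
Qed.

Lemma crt_single j (b : {poly %/ k j}) : exists c : {poly R},
  in_qpoly (k j) c = b /\ forall i, i != j -> in_qpoly (k i) c = 0.
Proof.
have [e [e1 e0]] := crt_idempotent j k_coprime.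
exists (e * val b); split=> [|i ij].
  rewrite in_qpolyM in_qpoly_val; suff -> : in_qpoly (k j) e = 1 by rewrite mul1r.
  apply/eqP; rewrite -subr_eq0 -(in_qpoly1 (k j)) -rmorphB; apply/eqP.
  exact/in_qpoly_eq0.
rewrite in_qpolyM; suff -> : in_qpoly (k i) e = 0 by rewrite mul0r.
by apply/in_qpoly_eq0 => //; apply: e0.
Qed.

(** Testing against the inversion of [c] instead of its reciprocal makes the
    condition depend on the residue class of [c] only. *)
Lemma orthP j (J : {set {poly %/ k j}}) (a : {poly %/ hat (k j)}) :
  a \in orth J <->
  {in J, forall c, a * in_qpoly (hat (k j)) (val c \Po w) = 0}.
Proof.
have inverse := mul_reciprocal_eq0 N_gt0 ul (hat_dvd_h' j).
rewrite inE; split=> [/forall_inP aJ c cJ | aJ].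
  by apply/inverse/eqP/aJ.
by apply/forall_inP=> c cJ; apply/eqP/inverse/aJ.
Qed.

Lemma dual_code_crt_sum (C : {set 'rV[R]_N}) (J : forall j, {set {poly %/ k j}}) :
    constacyclic l C -> (forall j, ideal_closed (J j)) ->
    code_ideal l C = crt_sum _ J ->
  code_ideal l^-1 (dual_code C) = crt_sum _ (fun j => orth (J j)).
Proof.
move=> [_ C_shift] J_ideal C_decomp.
have [hm hs] := (monicXnsubC l N_gt0, size_XnsubC l N_gt0).
have hs1 : (1 < size (h : {poly R}))%N by rewrite hs.
have [h'm h's] := (monicXnsubC l^-1 N_gt0, size_XnsubC l^-1 N_gt0).
have in_C (c : 'rV[R]_N) : (in_qpoly h (rVpoly c) \in code_ideal l C)
    <-> forall j, in_qpoly (k j) (rVpoly c) \in J j.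
  rewrite C_decomp inE; split=> [/setXnP cJ j | cJ].
    by have := cJ j; rewrite ffunE in_qpoly_in_qpoly.
  by apply/setXnP=> j; rewrite ffunE in_qpoly_in_qpoly; first apply: cJ.
have in_CE c : (in_qpoly h (rVpoly c) \in code_ideal l C) = (c \in C).
  rewrite in_code_ideal //= Pdiv.CommonRing.rmodp_small ?rVpolyK //.
  by rewrite mk_monicE // hs ltnS size_poly.
apply/setP=> a; rewrite in_code_ideal // [RHS]inE.
have sa : (size (val a) <= N)%N by have := size_qpoly a h'm; rewrite h's; apply.
apply/idP/setXnP.
  move=> /(dual_codeP N_gt0 ul _ C_shift) a_dual j; rewrite ffunE.
  apply/orthP=> b bJ; have [c [cb c0]] := crt_single b.
  (* the codeword whose only nonzero component is [b] *)
  pose c' : 'rV[R]_N := poly_rV (val (in_qpoly h c)).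
  have c'E i : in_qpoly (k i) (rVpoly c') = in_qpoly (k i) c.
    rewrite poly_rV_K ?in_qpoly_in_qpoly //.
    by have := size_qpoly (in_qpoly h c) hm; rewrite hs; apply.
  have c'C : c' \in C.
    rewrite -in_CE; apply/in_C=> i; rewrite c'E.
    have [->|ij] := eqVneq i j; first by rewrite cb.
    by rewrite c0 //; case: (J_ideal i).
  have := a_dual _ c'C; rewrite (poly_rV_K sa) => /in_qpoly_prod_hat /(_ j).
  rewrite in_qpolyM (@in_qpoly_comp_inv_var j (rVpoly c') (val b)) //.
  by rewrite c'E cb in_qpoly_val.
move=> a_orth; apply/(dual_codeP N_gt0 ul _ C_shift)=> c cC.
rewrite poly_rV_K //; apply/in_qpoly_prod_hat=> j.
have cJ : in_qpoly (k j) (rVpoly c) \in J j by apply: (in_C c).1; rewrite in_CE.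
have := a_orth j; rewrite ffunE => /orthP /(_ _ cJ).
rewrite in_qpolyM; congr (_ * _ = 0).
by apply: in_qpoly_comp_inv_var; rewrite in_qpoly_val.
Qed.

End DualDecomposition.

(** * Constants that are units *)

Lemma unitr_add_sqr0 (R : comUnitRingType) (a b : R) :
  a \is a GRing.unit -> b ^+ 2 = 0 -> a + b \is a GRing.unit.
Proof.
move=> ua b2; suff : (a - b) * (a + b) \is a GRing.unit by rewrite unitrM => /andP[].
by rewrite -subr_sqr b2 subr0 unitrX.
Qed.

Lemma teichmuller_unit (R : finComUnitRingType) (z a : R) M :
  M.-primitive_root z -> a \in teichmuller z M -> a != 0 -> a \is a GRing.unit.
Proof.
move=> zM; rewrite !inE => /orP[/eqP->|/imsetP[i _ ->] _]; first by rewrite eqxx.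
rewrite unitrX // -(@unitrX_pos _ _ M) ?(prim_order_gt0 zM) //.
by rewrite (prim_expr_order zM) unitr1.
Qed.

Theorem proposition3p2
  (R : finComUnitRingType) (gamma : R)
  (R_chain : chain_ring R) (gamma_max : maximal_ideal (principal gamma))
  (gamma_neq0 : gamma != 0) (gamma_sqr0 : gamma ^+ 2 = 0)
  (p m : nat) (p_prime : prime p)
  (F : finFieldType) (pi : {rmorphism R -> F})
  (pi_residue : residue_map gamma pi) (card_F : #|F| = (p ^ m)%N)
  (zeta : R) (zeta_order : (p ^ m - 1).-primitive_root zeta)
  (n s : nat) (n_gt0 : (0 < n)%N) (s_gt0 : (0 < s)%N) (n_coprime_p : coprime n p)
  (alpha beta alpha0 : R)
  (alpha_T : alpha \in teichmuller zeta (p ^ m - 1)) (alpha_neq0 : alpha != 0)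
  (beta_T : beta \in teichmuller zeta (p ^ m - 1))
  (alpha0_T : alpha0 \in teichmuller zeta (p ^ m - 1))
  (alpha0_root : alpha0 ^+ (p ^ s) = alpha)
  (r : nat) (f g k : 'I_r -> {poly R})
  (f_prod : 'X^n - alpha0%:P = \prod_(j < r) f j)
  (f_monic : forall j, f j \is monic)
  (f_coprime : forall i j, i != j -> comaximal (f i) (f j))
  (f_basic_irreducible : forall j, irreducible_poly (map_poly pi (f j)))
  (k_prod : 'X^(n * p ^ s) - (alpha + gamma * beta)%:P = \prod_(j < r) k j)
  (k_def : forall j, k j = f j ^+ (p ^ s) + gamma *: g j)
  (k_monic : forall j, k j \is monic)
  (k_coprime : forall i j, i != j -> comaximal (k i) (k j))
  (k_degree : forall j, size (k j) = ((size (f j)).-1 * p ^ s).+1)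
  (C : {set 'rV[R]_(n * p ^ s)}) (C_code : constacyclic (alpha + gamma * beta) C)
  (Cj : forall j, {set {poly %/ k j}}) (Cj_ideal : forall j, ideal_closed (Cj j))
  (C_decomp : code_ideal (alpha + gamma * beta) C = crt_sum _ Cj) :
  code_ideal (alpha + gamma * beta)^-1 (dual_code C)
    = crt_sum _ (fun j => orth (Cj j))
  /\ forall j, ideal_closed (orth (Cj j)).
Proof.
have N_gt0 : (0 < n * p ^ s)%N by rewrite muln_gt0 n_gt0 expn_gt0 prime_gt0.
have unit_lambda : alpha + gamma * beta \is a GRing.unit.
  apply: unitr_add_sqr0; first exact: teichmuller_unit zeta_order alpha_T alpha_neq0.
  by rewrite exprMn gamma_sqr0 mul0r.
have k_size j : (1 < size (k j))%N.
  rewrite k_degree ltnS muln_gt0 expn_gt0 (prime_gt0 p_prime) andbT -ltnS.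
  have [+ _] := f_basic_irreducible j => /leq_trans/(_ (size_poly _ _)) f_gt1.
  by rewrite prednK // ltnW.
split=> [|j]; last exact: orth_ideal.
exact: dual_code_crt_sum.
Qed.
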